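(* Let $P\subset\mathbb{R}^2$ be any quadrilateral, convex or non-convex, with vertices $\mathbf{p}_1,\mathbf{p}_2,\mathbf{p}_3,\mathbf{p}_4$ ordered anticlockwise, and let $Q\subset\mathbb{R}^2$ be a convex quadrilateral with vertices $\mathbf{q}_1,\mathbf{q}_2,\mathbf{q}_3,\mathbf{q}_4$ ordered anticlockwise. Let $\phi_1,\phi_2,\phi_3,\phi_4:\overline{P}\to\mathbb{R}$ be the mean value coordinates with respect to $P$. Then the mean value mapping $$\mathbf{f}:\overline{P}\to\mathbb{R}^2,\qquad \mathbf{f}(\mathbf{x})=\sum_{i=1}^4\phi_i(\mathbf{x})\,\mathbf{q}_i,$$ is injective.
   Context: A polygon (in particular a quadrilateral) $P\subset\mathbb{R}^2$ is the open region bounded by a simple closed polygonal curve with vertices $\mathbf{p}_1,\ldots,\mathbf{p}_n$ ordered anticlockwise ($n=4$ for a quadrilateral); $\partial P$ is its boundary and $\overline{P}$ its closure. Indices are treated cyclically modulo $n$ ($\mathbf{p}_{n+1}:=\mathbf{p}_1$ etc.). For $\mathbf{a}=(a^1,a^2)$, $\mathbf{b}=(b^1,b^2)$ write $\mathbf{a}\times\mathbf{b}:=a^1b^2-a^2b^1$. Mean value coordinates: for $\mathbf{x}\in P$ let $r_i:=\|\mathbf{p}_i-\mathbf{x}\|$ (Euclidean distance), $\mathbf{e}_i:=(\mathbf{p}_i-\mathbf{x})/r_i$, and let $\alpha_i\in(-\pi,\pi)$ be the signed angle at $\mathbf{x}$ in the triangle $[\mathbf{x},\mathbf{p}_i,\mathbf{p}_{i+1}]$,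 i.e. $\cos\alpha_i=\mathbf{e}_i\cdot\mathbf{e}_{i+1}$ and $\sin\alpha_i=\mathbf{e}_i\times\mathbf{e}_{i+1}$. Let $t_i:=\tan(\alpha_i/2)$, $$w_i(\mathbf{x}):=\frac{t_{i-1}+t_i}{r_i},\qquad W(\mathbf{x}):=\sum_{j=1}^n w_j(\mathbf{x}),\qquad \phi_i(\mathbf{x}):=\frac{w_i(\mathbf{x})}{W(\mathbf{x})}.$$ The functions $\phi_i$ have a unique continuous extension to $\overline{P}$, also denoted $\phi_i$; at a boundary point $\mathbf{x}=(1-\mu)\mathbf{p}_\ell+\mu\mathbf{p}_{\ell+1}$, $\mu\in[0,1]$, it is given by $\phi_\ell(\mathbf{x})=1-\mu$, $\phi_{\ell+1}(\mathbf{x})=\mu$, and $\phi_i(\mathbf{x})=0$ for $i\neq\ell,\ell+1$. *)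

(* Defs.v *)
From HB Require Import structures.
From mathcomp Require Import all_boot all_order all_algebra.
From mathcomp Require Import all_classical all_reals all_analysis.

Set Implicit Arguments.
Unset Strict Implicit.
Unset Printing Implicit Defensive.

Import Order.TTheory GRing.Theory Num.Theory.
Import numFieldNormedType.Exports.

Local Open Scope classical_set_scope.
Local Open Scope ring_scope.

Section Plane.
Variable R : realType.
Implicit Types a b : 'rV[R]_2.

Definition dot a b : R := a 0 0 * b 0 0 + a 0 1 * b 0 1.

Definition cross a b : R := a 0 0 * b 0 1 - a 0 1 * b 0 0.

(* The library norm `|a| on row vectors is the sup norm, hence this one. *)
Definition enorm a : R := Num.sqrt (dot a a).

End Plane.

Section Polygon.
Variables (R : realType) (n : nat).
Implicit Types (p : 'I_n -> 'rV[R]_2) (i l : 'I_n) (x : 'rV[R]_2).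

(* Vertices are indexed from 0, and [ordS]/[ord_pred] are the cyclic successor
   and predecessor. *)
Definition edge_point p l (mu : R) : 'rV[R]_2 :=
  (1 - mu) *: p l + mu *: p (ordS l).

Definition polygon_boundary p : set 'rV[R]_2 :=
  [set x | exists l mu, 0 <= mu <= 1 /\ x = edge_point p l mu].

(* The closed curve through the vertices is parametrised by pairs (l, mu) with
   mu in [0, 1[; it is simple when this parametrisation is injective. *)
Definition simple_closed p : Prop :=
  forall l l' (mu mu' : R), 0 <= mu < 1 -> 0 <= mu' < 1 ->
    edge_point p l mu = edge_point p l' mu' -> l = l' /\ mu = mu'.

(* Twice the signed area enclosed by the curve. *)
Definition signed_area2 p : R := \sum_i cross (p i) (p (ordS i)).

Definition anticlockwise p : Prop := 0 < signed_area2 p.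

(* The union of the bounded components of the complement of the curve; for a
   simple closed curve there is exactly one.  The first condition is needed
   because [connected_component A x] is empty, hence bounded, off [A]. *)
Definition polygon_region p : set 'rV[R]_2 :=
  [set x | ~ polygon_boundary p x /\
     bounded_set (connected_component (~` polygon_boundary p) x)].

Definition mv_dist p x i : R := enorm (p i - x).

Definition mv_dir p x i : 'rV[R]_2 := (mv_dist p x i)^-1 *: (p i - x).

(* For x off the curve such an angle exists and is unique. *)
Definition mv_angle p x i : R :=
  xget 0 [set a : R | - pi < a < pi /\
    cos a = dot (mv_dir p x i) (mv_dir p x (ordS i)) /\
    sin a = cross (mv_dir p x i) (mv_dir p x (ordS i))].

Definition mv_tan p x i : R := tan (mv_angle p x i / 2).

Definition mv_weight p x i : R :=
  (mv_tan p x (ord_pred i) + mv_tan p x i) / mv_dist p x i.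

(* The i-th coordinate function at the point (1 - mu) p_l + mu p_(l+1). *)
Definition edge_value i l (mu : R) : R :=
  if i == l then 1 - mu else if i == ordS l then mu else 0.

(* The extension of the mean value coordinates to the closed polygon; for a
   simple curve the value on the boundary does not depend on the choice of
   (l, mu), see [mv_coord_boundary].  The value 0 outside of the closed polygon
   is a dummy. *)
Definition mv_coord p i x : R :=
  if x \in polygon_region p then mv_weight p x i / \sum_j mv_weight p x j
  else xget 0 [set v : R | exists l mu, [/\ 0 <= mu <= 1,
                 x = edge_point p l mu & v = edge_value i l mu]].

Definition mv_map p (q : 'I_n -> 'rV[R]_2) x : 'rV[R]_2 :=
  \sum_i mv_coord p i x *: q i.

Lemma simple_ordS p l : simple_closed p -> ordS l != l.
Proof.
move=> sp; apply/eqP => e.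
have h0 : 0 <= (0 : R) < 1 by rewrite lexx ltr01.
have h1 : 0 <= (2^-1 : R) < 1.
  by rewrite invr_ge0 ler0n invf_lt1 ?ltr0n // ltr1n.
have [|_ /esym/eqP] := sp l l _ _ h0 h1.
  by rewrite /edge_point e -!scalerDl !subrK.
by rewrite invr_eq0 pnatr_eq0.
Qed.

Lemma edge_value1 p i l : simple_closed p ->
  edge_value i l 1 = edge_value i (ordS l) 0.
Proof.
move=> sp; rewrite /edge_value subrr subr0.
case: (eqVneq i l) => [->|_]; last by case: eqP => // _; case: eqP.
by rewrite eq_sym (negPf (simple_ordS l sp)) if_same.
Qed.

Lemma mv_coord_boundary p i l (mu : R) : simple_closed p -> 0 <= mu <= 1 ->
  mv_coord p i (edge_point p l mu) = edge_value i l mu.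
Proof.
move=> sp mu01; rewrite /mv_coord ifF; last first.
  by apply/negbTE/negP; rewrite inE => -[+ _]; apply; exists l, mu.
have norm l0 (m0 : R) : 0 <= m0 <= 1 -> exists l1 m1, [/\ 0 <= m1 < 1,
    edge_point p l0 m0 = edge_point p l1 m1 &
    edge_value i l0 m0 = edge_value i l1 m1].
  move=> /andP[m0ge]; rewrite le_eqVlt => /orP[/eqP ->|m0lt].
    exists (ordS l0), 0; rewrite lexx ltr01; split=> //.
      by rewrite /edge_point subrr subr0 !scale0r !scale1r addr0 add0r.
    exact: edge_value1 sp.
  by exists l0, m0; rewrite m0ge m0lt.
apply: xget_unique; first by exists l, mu.
move=> v [l' [mu' [mu'01 e ->]]].
have [l1 [m1 [h1 e1 v1]]] := norm l' mu' mu'01.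
have [l2 [m2 [h2 e2 v2]]] := norm l mu mu01.
have [|el em] := sp l1 l2 m1 m2 h1 h2; first by rewrite -e1 -e2.
by rewrite v1 v2 el em.
Qed.

End Polygon.

(* Main.v *)
Require Import Defs.
From HB Require Import structures.
From mathcomp Require Import all_boot all_order all_algebra.
From mathcomp Require Import all_classical all_reals all_analysis.
From mathcomp Require Import ring lra.
Import Order.TTheory GRing.Theory Num.Theory.
Import numFieldNormedType.Exports.
Local Open Scope classical_set_scope.
Local Open Scope ring_scope.

(** The proof rests on an invariant of the mean value coordinates that detects
    the two diagonals of [P]. Since the product of [w_i] and [r_i] is the sum
    of [t_(i-1)] and [t_i], the alternating sum of the [phi_i * |p_i - x|]
    vanishes for every [x], on the boundary as well as inside.

    Let [f x = f y] with [x] and [y] distinct. The difference [delta] of the two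
    coordinate vectors sums to zero and annihilates the vertices of the convex
    quadrilateral [Q], hence it is proportional to the signed areas of the
    corners of [Q] taken with alternating signs: [delta] is weakly positive on
    one diagonal and weakly negative on the other ([dependency_signs]). With
    signs [eps_i] equal to [+1] on the first diagonal and to [-1] on the second,
    the alternating sum can only grow in such a direction. Indeed, writing [r_i]
    and [r'_i] for the distances of [p_i] to [x] and to [y], and [b'] for the
    coordinates of [y], its increment from [y] to [x] is
      (sum |delta_i| r_i - |x - y|) + sum b'_i (|x - y| + eps_i (r_i - r'_i)).
    The first bracket is nonnegative because [x - y] is the sum of the
    [delta_i (p_i - x)], the others by the triangle inequality. As the
    increment is zero, all terms vanish ([alternating_moment_rigid]). If [y] is
    inside [P], where all coordinates are positive, the triangle inequalities
    are equalities for all four vertices, so that these lie on the line through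
    [x] and [y], which contradicts the positive area of [P]
    ([mv_map_region_inj]); the roles of [x] and [y] can be exchanged. If both
    are on the boundary, it suffices that [f] maps each edge affinely to the
    corresponding edge of [Q], whose boundary is simple.

    The positivity of the coordinates inside [P] is read off from the
    polynomial relation between the half-angle tangents which says that the
    four angles add up to a multiple of a full turn ([mv_tan_closed]). The
    topology is elementary: a simple quadrilateral has a diagonal that splits
    it into two triangles ([exists_splits]), and the union of these two closed
    triangles is the bounded component of the complement together with the
    curve ([region_hull], [hull_region]). *)

Set Implicit Arguments.
Unset Strict Implicit.
Unset Printing Implicit Defensive.

(** * Euclidean geometry of the plane *)

Section PlaneGeometry.
Variable R : realType.
Implicit Types (a b c d x y : 'rV[R]_2) (s t : R).

Lemma row2P a b : a 0 0 = b 0 0 -> a 0 1 = b 0 1 -> a = b.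
Proof.
move=> e0 e1; apply/rowP => j.
have /orP[/eqP->|/eqP->] // : (j == 0) || (j == 1).
by case: j => [[|[|]]].
Qed.

Definition orient a b c : R := cross (b - a) (c - a).

Lemma orientE a b c : orient a b c =
  (b 0 0 - a 0 0) * (c 0 1 - a 0 1) - (b 0 1 - a 0 1) * (c 0 0 - a 0 0).
Proof. by rewrite /orient /cross !mxE. Qed.

Lemma orient_rot a b c : orient b c a = orient a b c.
Proof. by rewrite !orientE; ring. Qed.

Lemma orient_comb a b c d t :
  orient a b ((1 - t) *: c + t *: d) = (1 - t) * orient a b c + t * orient a b d.
Proof. by rewrite !orientE !mxE; ring. Qed.

Lemma dotE a b : dot a b = a 0 0 * b 0 0 + a 0 1 * b 0 1. Proof. by []. Qed.

Lemma dot_ge0 a : 0 <= dot a a.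
Proof. by rewrite /dot -!expr2 addr_ge0 // sqr_ge0. Qed.

Lemma enorm_ge0 a : 0 <= enorm a. Proof. exact: sqrtr_ge0. Qed.

Lemma sqr_enorm a : enorm a ^+ 2 = dot a a.
Proof. by rewrite /enorm sqr_sqrtr // dot_ge0. Qed.

Lemma enorm_eq0 a : (enorm a == 0) = (a == 0).
Proof.
apply/eqP/eqP => [a0|->]; last first.
  by rewrite /enorm /dot !mxE !mul0r addr0 sqrtr0.
have : dot a a = 0 by rewrite -sqr_enorm a0 expr0n.
rewrite dotE -!expr2 => /eqP; rewrite paddr_eq0 ?sqr_ge0 // !sqrf_eq0.
by move=> /andP[/eqP h0 /eqP h1]; apply: row2P; rewrite mxE.
Qed.

Lemma enormZ t a : enorm (t *: a) = `|t| * enorm a.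
Proof.
apply/eqP; rewrite -(@eqrXn2 _ 2) ?mulr_ge0 ?enorm_ge0 //.
by rewrite exprMn !sqr_enorm -normrX ger0_norm ?sqr_ge0 // /dot !mxE; apply/eqP; ring.
Qed.

Lemma enormN a : enorm (- a) = enorm a.
Proof. by rewrite -scaleN1r enormZ normrN1 mul1r. Qed.

Lemma lagrange_identity a b :
  (enorm a * enorm b) ^+ 2 = dot a b ^+ 2 + cross a b ^+ 2.
Proof. by rewrite exprMn !sqr_enorm /dot /cross; ring. Qed.

Lemma dot_le a b : dot a b <= enorm a * enorm b.
Proof.
apply: le_trans (ler_norm _) _.
rewrite -(@ler_pXn2r _ 2) ?nnegrE ?mulr_ge0 ?enorm_ge0 //.
rewrite -normrX ger0_norm ?sqr_ge0 // lagrange_identity lerDl; exact: sqr_ge0.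
Qed.

Lemma sqr_enormD a b :
  enorm (a + b) ^+ 2 = enorm a ^+ 2 + 2 * dot a b + enorm b ^+ 2.
Proof. by rewrite !sqr_enorm /dot !mxE; ring. Qed.

Lemma enorm_triangle a b : enorm (a + b) <= enorm a + enorm b.
Proof.
rewrite -(@ler_pXn2r _ 2) ?nnegrE ?addr_ge0 ?enorm_ge0 //.
by rewrite sqr_enormD; have := dot_le a b; nra.
Qed.

Lemma enorm_triangle_eq a b : enorm (a + b) = enorm a + enorm b -> cross a b = 0.
Proof.
move=> e; have := sqr_enormD a b; rewrite e => e2.
have de : dot a b = enorm a * enorm b by nra.
have := lagrange_identity a b; rewrite de => lag.
by apply/eqP; rewrite -sqrf_eq0; apply/eqP; lra.
Qed.

Lemma enorm_sum (I : finType) (F : I -> 'rV[R]_2) :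
  enorm (\sum_i F i) <= \sum_i enorm (F i).
Proof.
elim/big_rec2: _ => [|i y x _ IH]; first by rewrite le_eqVlt enorm_eq0 eqxx.
by apply: le_trans (enorm_triangle _ _) _; rewrite lerD2l.
Qed.

End PlaneGeometry.

(** * Monotonicity of the alternating distance sum *)

Section AlternatingMoment.
Variables (R : realType) (I : finType) (p : I -> 'rV[R]_2) (eps : I -> bool).
Implicit Types (b : I -> R) (x y : 'rV[R]_2).

Local Notation sg i := ((-1) ^+ eps i : R).

Definition alternating_moment b x : R :=
  \sum_i sg i * (b i * enorm (p i - x)).

Definition barycentric b x : Prop :=
  [/\ forall i, 0 <= b i, \sum_i b i = 1 & \sum_i b i *: p i = x].

(** The alternating sum grows when weight is moved towards the points of sign
    [+1]: the direct gain [sum |b i - b' i| * |p i - x|] is at least the length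
    of the displacement [x - y], and the displacement costs at most its length
    because the weights [b'] have sum 1. Equality in this balance is equality
    in the triangle inequality at every point that carries weight. *)
Lemma alternating_moment_rigid b b' x y :
  barycentric b x -> barycentric b' y ->
  (forall i, 0 <= sg i * (b i - b' i)) ->
  alternating_moment b x = alternating_moment b' y ->
  forall i, b' i * (enorm (x - y) + sg i * (enorm (p i - x) - enorm (p i - y))) = 0.
Proof.
move=> [_ b1 bx] [b'0 b'1 b'y] dsg mom.
have diff_le : enorm (x - y) <= \sum_i sg i * (b i - b' i) * enorm (p i - x).
  have -> : x - y = \sum_i (b i - b' i) *: (p i - x).
    under eq_bigr do rewrite scalerBr.
    rewrite sumrB -scaler_suml sumrB b1 b'1 subrr scale0r subr0.
    under eq_bigr do rewrite scalerBl.
    by rewrite sumrB bx b'y.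
  apply: le_trans (enorm_sum _) _; apply: ler_sum => i _.
  rewrite enormZ -[`|_|](_ : `|sg i * (b i - b' i)| = _); last first.
    by rewrite normrM normr_sign mul1r.
  by rewrite ger0_norm.
have term_ge0 i :
    0 <= b' i * (enorm (x - y) + sg i * (enorm (p i - x) - enorm (p i - y))).
  apply: mulr_ge0 => //.
  have t1 : enorm (p i - x) <= enorm (p i - y) + enorm (x - y).
    rewrite -[enorm (x - y)]enormN; apply: le_trans (enorm_triangle _ _).
    by rewrite opprB addrA subrK.
  have t2 : enorm (p i - y) <= enorm (p i - x) + enorm (x - y).
    by apply: le_trans (enorm_triangle _ _); rewrite addrA subrK.
  by case: (eps i); rewrite ?expr1 ?expr0; lra.
have sum0 :
    \sum_i b' i * (enorm (x - y) + sg i * (enorm (p i - x) - enorm (p i - y))) = 0.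
  apply/eqP; rewrite eq_le sumr_ge0 ?andbT //.
  under eq_bigr do rewrite mulrDr.
  rewrite big_split /= -mulr_suml b'1 mul1r.
  rewrite -(@lerD2r _ (- enorm (x - y))) addrAC subrr !add0r.
  have -> : \sum_i b' i * (sg i * (enorm (p i - x) - enorm (p i - y))) =
      - \sum_i sg i * (b i - b' i) * enorm (p i - x).
    apply/eqP; rewrite -addr_eq0 -big_split /=; apply/eqP.
    transitivity (alternating_moment b x - alternating_moment b' y).
      by rewrite /alternating_moment -sumrB; apply: eq_bigr => i _; ring.
    by rewrite mom subrr.
  by rewrite lerN2.
move=> i; apply/eqP.
have /eqP := sum0; rewrite psumr_eq0 // => /allP/(_ i); apply.
by rewrite mem_index_enum.
Qed.

(** Equality in the triangle inequality puts each point on the line through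
    [x] and [y], beyond [x] or beyond [y] according to its sign. *)
Lemma alternating_moment_aligned b b' x y :
  barycentric b x -> barycentric b' y ->
  (forall i, 0 <= sg i * (b i - b' i)) ->
  alternating_moment b x = alternating_moment b' y ->
  (forall i, 0 < b' i) -> forall i, cross (p i - x) (x - y) = 0.
Proof.
move=> bx b'y dsg mom b'0 i.
have /eqP := alternating_moment_rigid bx b'y dsg mom i.
rewrite mulf_eq0 gt_eqF //= => /eqP.
case: (eps i); rewrite ?expr1 ?expr0 => e.
  have : enorm (p i - y + (y - x)) = enorm (p i - y) + enorm (y - x).
    by rewrite addrA subrK -[enorm (y - x)]enormN opprB; lra.
  by move=> /enorm_triangle_eq; rewrite /cross !mxE; lra.
apply: enorm_triangle_eq; rewrite addrA subrK; lra.
Qed.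

End AlternatingMoment.

(** * Splitting a simple quadrilateral along a diagonal *)

Local Notation nx := ordS.

Section CyclicIndices.
Implicit Types i j : 'I_4.

Lemma ord4P i j : [\/ j = i, j = nx i, j = nx (nx i) | j = nx (nx (nx i))].
Proof.
by case: i => [[|[|[|[|]]]]] //= hi; case: j => [[|[|[|[|]]]]] //= hj;
  solve [constructor 1; exact: val_inj | constructor 2; exact: val_inj
        |constructor 3; exact: val_inj | constructor 4; exact: val_inj].
Qed.

Lemma ordS4 i : nx (nx (nx (nx i))) = i.
Proof. by case: i => [[|[|[|[|]]]]] //= hi; apply: val_inj. Qed.

Lemma ord_pred4 i : ord_pred i = nx (nx (nx i)).
Proof. by rewrite -[i in LHS]ordS4 ordSK. Qed.

Lemma uniq4 i : uniq [:: i; nx i; nx (nx i); nx (nx (nx i))].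
Proof. by case: i => [[|[|[|[|]]]]]. Qed.

Lemma odd_ordS4 i : odd (nx i) = ~~ odd i.
Proof. by case: i => [[|[|[|[|]]]]]. Qed.

Lemma sum4 (V : nmodType) (F : 'I_4 -> V) i :
  \sum_j F j = F i + F (nx i) + F (nx (nx i)) + F (nx (nx (nx i))).
Proof.
rewrite (perm_big [:: i; nx i; nx (nx i); nx (nx (nx i))]).
  by rewrite !big_cons big_nil /= addr0 !addrA.
apply: uniq_perm; [exact: index_enum_uniq|exact: uniq4|move=> j].
by rewrite mem_index_enum; have [] := ord4P i j => ->; rewrite !inE eqxx ?orbT.
Qed.

Lemma forall4 (P : 'I_4 -> Prop) i :
  P i -> P (nx i) -> P (nx (nx i)) -> P (nx (nx (nx i))) -> forall j, P j.
Proof. by move=> ? ? ? ? j; have [] := ord4P i j => ->. Qed.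

End CyclicIndices.

Section Split.
Variable R : realType.
Implicit Types (p q : 'I_4 -> 'rV[R]_2) (i j l : 'I_4) (a b c x y : 'rV[R]_2).

Definition corner p i : R := orient (p i) (p (nx i)) (p (nx (nx i))).

Lemma corner_sum p i : signed_area2 p = corner p i + corner p (nx (nx i)).
Proof. by rewrite /signed_area2 (sum4 _ i) /corner !ordS4 !orientE /cross; ring. Qed.

Lemma edge_point1 p l : edge_point p l 1 = edge_point p (nx l) 0.
Proof. by rewrite /edge_point subrr subr0 !scale0r !scale1r addr0 add0r. Qed.

Lemma edge_point_half_open l (mu : R) : 0 <= mu <= 1 ->
  exists l1 m1, [/\ l1 = l \/ l1 = nx l, 0 <= m1 < 1 &
                    forall p, edge_point p l mu = edge_point p l1 m1].
Proof.
move=> /andP[m0]; rewrite le_eqVlt => /orP[/eqP->|m1].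
  by exists (nx l), 0; rewrite lexx ltr01; split=> // [|p]; [right|exact: edge_point1].
by exists l, mu; rewrite m0 m1; split => //; left.
Qed.

Lemma ratio_itv01 (s t : R) : 0 < t -> 0 <= s <= t -> 0 <= s / t <= 1.
Proof.
move=> t0 /andP[s0 st].
by rewrite ler_pdivrMr // mul1r st andbT divr_ge0 // ltW.
Qed.

(** The curve is parametrised by half-open edges, but opposite closed edges
    have no common end either, so that they do not meet at all. *)
Lemma opposite_edges_disjoint p i (mu mu' : R) : simple_closed p ->
  0 <= mu <= 1 -> 0 <= mu' <= 1 ->
  edge_point p i mu <> edge_point p (nx (nx i)) mu'.
Proof.
move=> sp /(edge_point_half_open i)[l [m [hl hm ->]]].
move=> /(edge_point_half_open (nx (nx i)))[l' [m' [hl' hm' ->]]].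
move=> /(sp _ _ _ _ hm hm')[e _].
have := uniq4 i; case: hl => hl; case: hl' => hl'; rewrite hl hl' in e;
  by rewrite /= !inE -?e ?eqxx ?orbT ?andbF.
Qed.

(** With the signs assumed here, the affine dependency between the vertices,
    whose coefficients are the areas of the corners, equates a convex
    combination of the ends of one edge with one of the ends of the opposite
    edge: these edges would cross. *)
Lemma reflex_not_adjacent p i : simple_closed p ->
  corner p i <= 0 -> corner p (nx i) <= 0 ->
  0 < corner p (nx (nx i)) -> 0 < corner p (nx (nx (nx i))) -> False.
Proof.
move=> sp c0 c1 c2 c3.
have area := corner_sum p i; rewrite (corner_sum p (nx i)) in area.
(* Both sides of the dependency have this total weight. *)
have T_gt0 : 0 < corner p (nx (nx i)) - corner p (nx i) by lra.
have T_neq0 := lt0r_neq0 T_gt0.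
apply: (@opposite_edges_disjoint p i
  (corner p (nx (nx i)) / (corner p (nx (nx i)) - corner p (nx i)))
  (- corner p i / (corner p (nx (nx i)) - corner p (nx i))) sp).
- by apply: ratio_itv01 => //; lra.
- by apply: ratio_itv01 => //; lra.
apply: (scalerI T_neq0).
rewrite /edge_point !scalerDr !scalerA !mulrBr !mulr1 !(mulrC (_ - _) (_ / _)).
rewrite !divfK //; move: area; rewrite /corner !ordS4 => area.
apply: row2P; rewrite !mxE; move: area; rewrite !orientE; nra.
Qed.

(** The diagonal from [p i] to [p (i + 2)] separates the two other vertices,
    [p (i + 1)] lying on its right. *)
Definition splits p i : Prop := 0 < corner p i /\ 0 < corner p (nx (nx i)).

Lemma splits_opposite p i : splits p i -> splits p (nx (nx i)).
Proof. by move=> [? ?]; split=> //; rewrite ordS4. Qed.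

(** Two opposite corners have a positive total area. If neither diagonal
    splits, each pair of opposite corners has exactly one that is not positive,
    and these two are adjacent. *)
Lemma exists_splits p : simple_closed p -> anticlockwise p -> exists i, splits p i.
Proof.
move=> sp; rewrite /anticlockwise => pos.
have s0 := corner_sum p 0; have s1 := corner_sum p (nx 0).
have n0 := @reflex_not_adjacent p 0 sp.
have n1 := @reflex_not_adjacent p (nx 0) sp.
have n2 := @reflex_not_adjacent p (nx (nx 0)) sp.
have n3 := @reflex_not_adjacent p (nx (nx (nx 0))) sp.
rewrite !ordS4 in n1 n2 n3.
case: (ltP 0 (corner p 0)) => h0; case: (ltP 0 (corner p (nx (nx 0)))) => h2;
  try by exists 0.
all: case: (ltP 0 (corner p (nx 0))) => h1;
  case: (ltP 0 (corner p (nx (nx (nx 0))))) => h3;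
  try by exists (nx 0).
all: try lra.
all: exfalso; first [by apply: n0|by apply: n1|by apply: n2|by apply: n3].
Qed.

End Split.

(** * The region enclosed by a quadrilateral *)

Section Region.
Variable R : realType.
Implicit Types (p q : 'I_4 -> 'rV[R]_2) (i j l : 'I_4) (a b c d x y : 'rV[R]_2).

Definition triangle a b c x : Prop :=
  [/\ 0 <= orient a b x, 0 <= orient b c x & 0 <= orient c a x].

Lemma triangle_convex a b c x y (t : R) : 0 <= t <= 1 ->
  triangle a b c x -> triangle a b c y -> triangle a b c ((1 - t) *: x + t *: y).
Proof.
move=> /andP[t0 t1] [x1 x2 x3] [y1 y2 y3].
by split; rewrite orient_comb addr_ge0 // mulr_ge0 // subr_ge0.
Qed.

(** Cramer's rule for the barycentric coordinates in a triangle. *)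
Lemma orient_barycentric a b c x :
  orient a b c *: x = orient b c x *: a + orient c a x *: b + orient a b x *: c.
Proof. by apply: row2P; rewrite !orientE !mxE; ring. Qed.

Lemma orient_barycentric_sum a b c x :
  orient a b c = orient b c x + orient c a x + orient a b x.
Proof. by rewrite !orientE; ring. Qed.

Lemma triangle_norm_le a b c x : 0 < orient a b c -> triangle a b c x ->
  `|x| <= `|a| + `|b| + `|c|.
Proof.
move=> T [x1 x2 x3]; have s := orient_barycentric_sum a b c x.
rewrite -(ler_pM2l T) -[X in X * _ <= _](gtr0_norm T) -normrZ orient_barycentric.
apply: le_trans (ler_normD _ _) _; rewrite 2!mulrDr.
apply: lerD; first (apply: le_trans (ler_normD _ _) _; apply: lerD).
all: by rewrite normrZ ger0_norm // ler_wpM2r //; lra.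
Qed.

Lemma triangle_side a b c x : 0 < orient a b c -> triangle a b c x ->
  orient a b x = 0 -> exists2 mu : R, 0 <= mu <= 1 & x = (1 - mu) *: a + mu *: b.
Proof.
move=> T [x1 x2 x3] x0; have s := orient_barycentric_sum a b c x.
have T0 := lt0r_neq0 T.
exists (orient c a x / orient a b c).
  by apply: ratio_itv01 => //; lra.
apply: (scalerI T0); rewrite orient_barycentric x0 scale0r addr0.
rewrite scalerDr !scalerA mulrBr mulr1 mulrCA divff // mulr1.
by congr (_ *: _ + _); lra.
Qed.

Lemma triangle_vertices a b c : 0 < orient a b c ->
  [/\ triangle a b c a, triangle a b c b & triangle a b c c].
Proof. by rewrite /triangle !orientE => T; split; split; lra. Qed.

Definition hull p i x : Prop :=
  triangle (p i) (p (nx i)) (p (nx (nx i))) x \/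
  triangle (p (nx (nx i))) (p (nx (nx (nx i)))) (p i) x.

Lemma boundary_hull p i : splits p i -> polygon_boundary p `<=` hull p i.
Proof.
move=> [s0]; rewrite /corner !ordS4 => s2 x [l [mu [mu01 ->]]].
have [a1 b1 c1] := triangle_vertices s0.
have [c2 d2 a2] := triangle_vertices s2.
rewrite /edge_point; have [] := ord4P i l => ->; rewrite ?ordS4.
- by left; apply: triangle_convex.
- by left; apply: triangle_convex.
- by right; apply: triangle_convex.
- by right; apply: triangle_convex.
Qed.

(** The midpoint of the splitting diagonal belongs to both triangles, from
    which their union is star-shaped. *)
Lemma hull_star p i x (t : R) : splits p i -> 0 <= t <= 1 -> hull p i x ->
  hull p i ((1 - t) *: (2^-1 *: (p i + p (nx (nx i)))) + t *: x).
Proof.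
move=> [s0]; rewrite /corner !ordS4 => s2 t01.
have [a1 b1 c1] := triangle_vertices s0.
have [c2 d2 a2] := triangle_vertices s2.
have half : 0 <= (2^-1 : R) <= 1 by lra.
have e : 2^-1 *: (p i + p (nx (nx i))) =
    (1 - 2^-1) *: p i + 2^-1 *: p (nx (nx i)).
  by rewrite scalerDr; congr (_ *: _ + _); lra.
by case=> h; [left|right]; apply: triangle_convex => //;
  rewrite e; apply: triangle_convex.
Qed.

(** The points of the hull off the curve, by open conditions: the interiors of
    the two triangles, and a neighbourhood of the open diagonal, given by the
    points on the left of all edges. *)
Definition core p i x : Prop :=
  let o j := 0 < orient (p j) (p (nx j)) x in
  let diag := orient (p (nx (nx i))) (p i) x in
  [\/ [/\ o i, o (nx i) & 0 < diag],
      [/\ o (nx (nx i)), o (nx (nx (nx i))) & diag < 0] |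
      forall j, o j].

Lemma orientN a b x : orient a b x = - orient b a x.
Proof. by rewrite !orientE; ring. Qed.

Lemma core_opposite p i x : core p i x -> core p (nx (nx i)) x.
Proof.
rewrite /core !ordS4 => -[ [? ? d]| [? ? d]|?]; last by constructor 3.
- by constructor 2; split=> //; rewrite orientN oppr_lt0.
- by constructor 1; split=> //; rewrite orientN oppr_gt0.
Qed.

Lemma core_hull p i : core p i `<=` hull p i.
Proof.
move=> x [ [h0 h1 d]| [h2 h3 d]|h].
- by left; split; apply: ltW.
- right; split; [exact: ltW|move: h3; rewrite ordS4; exact: ltW|].
  by rewrite orientN oppr_ge0 ltW.
- have := h i; have := h (nx i); have := h (nx (nx i)); have := h (nx (nx (nx i))).
  rewrite ordS4 => h3 h2 h1 h0.
  case: (leP 0 (orient (p (nx (nx i))) (p i) x)) => d.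
    by left; split=> //; exact: ltW.
  by right; split; try exact: ltW; rewrite orientN oppr_ge0 ltW.
Qed.

Lemma orient_affine a b c d x (s t r : R) :
  r *: x = s *: c + t *: d -> r = s + t ->
  r * orient a b x = s * orient a b c + t * orient a b d.
Proof.
move=> e rst.
have := congr1 (fun y : 'rV[R]_2 => y 0 0) e.
have := congr1 (fun y : 'rV[R]_2 => y 0 1) e.
rewrite /= !mxE => e1 e0; rewrite !orientE.
have -> : r * ((b 0 0 - a 0 0) * (x 0 1 - a 0 1) -
      (b 0 1 - a 0 1) * (x 0 0 - a 0 0)) =
    (b 0 0 - a 0 0) * (r * x 0 1 - r * a 0 1) -
      (b 0 1 - a 0 1) * (r * x 0 0 - r * a 0 0) by ring.
by rewrite e0 e1 rst; ring.
Qed.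

(** Only one side of the triangle is not part of the curve, the diagonal; a
    point strictly between its ends is on the left of all four edges. *)
Lemma triangle_core p i x : splits p i -> ~ polygon_boundary p x ->
  triangle (p i) (p (nx i)) (p (nx (nx i))) x -> core p i x.
Proof.
move=> [s0 s2] nb T.
have off j : 0 <= orient (p j) (p (nx j)) x ->
    (orient (p j) (p (nx j)) x = 0 ->
      exists2 mu : R, 0 <= mu <= 1 & x = (1 - mu) *: p j + mu *: p (nx j)) ->
    0 < orient (p j) (p (nx j)) x.
  move=> ge0 side; rewrite lt_neqAle ge0 andbT eq_sym; apply/eqP => /side.
  by move=> [mu mu01 e]; apply: nb; exists j, mu.
case: (T) => T0 T1 T2.
have o0 : 0 < orient (p i) (p (nx i)) x.
  by apply: off => // o; exact: triangle_side s0 T o.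
have o1 : 0 < orient (p (nx i)) (p (nx (nx i))) x.
  apply: off => // o; have := @triangle_side (p (nx i)) (p (nx (nx i))) (p i) x.
  by rewrite orient_rot; apply.
move: T2; rewrite le_eqVlt => /orP[/eqP d|d]; last by constructor 1.
constructor 3.
(* On the diagonal, the sides of the second triangle see [x] as they see a
   convex combination of the ends of the diagonal. *)
have s := orient_barycentric_sum (p i) (p (nx i)) (p (nx (nx i))) x.
have bar := orient_barycentric (p i) (p (nx i)) (p (nx (nx i))) x.
move: s0 s2 s; rewrite /corner !ordS4 -d scale0r addr0 in bar *.
set a := p i; set b := p (nx i); set c := p (nx (nx i)).
set e := p (nx (nx (nx i))); rewrite addr0 => s0 s2 s.
have side u v : orient a b c * orient u v x =
    orient b c x * orient u v a + orient a b x * orient u v c.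
  exact: (orient_affine u v bar s).
apply: (forall4 (i := i)) => //; rewrite ?ordS4 -/a -/b -/c -/e;
  rewrite -(pmulr_rgt0 _ s0) side.
- have -> : orient c e c = 0 by rewrite orientE; ring.
  by rewrite mulr0 addr0 mulr_gt0.
- have -> : orient e a a = 0 by rewrite orientE; ring.
  by rewrite mulr0 add0r mulr_gt0 // orient_rot.
Qed.

Lemma hull_core p i x : splits p i -> hull p i x -> ~ polygon_boundary p x ->
  core p i x.
Proof.
move=> s [T|T] nb; first exact: triangle_core.
rewrite -(ordS4 i); apply: core_opposite; apply: triangle_core => //.
  exact: splits_opposite.
by rewrite ordS4.
Qed.

Lemma orient_continuous a b : continuous (orient a b : 'rV[R]_2 -> R).
Proof.
pose coord k : 'rV[R]_2 -> R := fun c => c 0 k.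
have coordP k : continuous (coord k) by exact: coord_continuous.
rewrite (_ : orient a b =
    (fun=> b 0 0 - a 0 0) \* (coord 1 - (fun=> a 0 1)) -
    (fun=> b 0 1 - a 0 1) \* (coord 0 - (fun=> a 0 0))); last first.
  by apply/funext => c; rewrite orientE.
have factor k (u v : R) : continuous ((fun=> u) \* (coord k - (fun=> v))).
  move=> x; apply: (@continuousM); first exact: cst_continuous.
  by apply: (@continuousB); [exact: coordP|exact: cst_continuous].
by move=> x; apply: (@continuousB); exact: factor.
Qed.

Lemma open_orient_gt0 a b : open [set x | 0 < orient a b x].
Proof.
have := open_comp (fun x _ => @orient_continuous a b x) (@open_gt R 0).
by [].
Qed.

Lemma open_orient_lt0 a b : open [set x | orient a b x < 0].
Proof.
have := open_comp (fun x _ => @orient_continuous a b x) (@open_lt R 0).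
by [].
Qed.

Lemma closed_orient_ge0 a b : closed [set x | 0 <= orient a b x].
Proof.
have := closed_comp (fun x _ => @orient_continuous a b x) (@closed_ge R 0).
by [].
Qed.

Lemma open_core p i : open (core p i).
Proof.
pose h j := [set x | 0 < orient (p j) (p (nx j)) x].
pose d := orient (p (nx (nx i))) (p i).
rewrite (_ : core p i = (h i `&` h (nx i) `&` [set x | 0 < d x])
  `|` (h (nx (nx i)) `&` h (nx (nx (nx i))) `&` [set x | d x < 0])
  `|` (h i `&` h (nx i) `&` h (nx (nx i)) `&` h (nx (nx (nx i))))).
  repeat first [apply: openU|apply: openI|exact: open_orient_gt0
               |exact: open_orient_lt0].
apply/seteqP; split=> x.
  case=> [ [? ? ?]| [? ? ?]|o]; [by do 2 left|by left; right|right].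
  by do 3 (split; last exact: o); exact: o.
case=> [ [ [ [? ?] ?]|[ [? ?] ?] ]|[ [ [? ?] ?] ?] ].
- by constructor 1.
- by constructor 2.
- by constructor 3; apply: (forall4 (i := i)).
Qed.

Lemma closed_triangle a b c : closed (triangle a b c).
Proof.
rewrite (_ : triangle a b c = [set x | 0 <= orient a b x] `&`
  [set x | 0 <= orient b c x] `&` [set x | 0 <= orient c a x]).
  by repeat first [apply: closedI|exact: closed_orient_ge0].
by apply/seteqP; split=> x; [case|case=> -[]].
Qed.

Lemma closed_hull p i : closed (hull p i).
Proof. by apply: closedU; exact: closed_triangle. Qed.

(** Off the curve the closed hull agrees with its open core, so that it
    contains the whole connected component of each of its points. *)
Lemma hull_region p i x : splits p i -> hull p i x -> ~ polygon_boundary p x ->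
  polygon_region p x.
Proof.
move=> s hx nbx; split=> //.
set C := connected_component _ x.
have Cx : C x by exact: connected_component_refl.
have CB : C `<=` ~` polygon_boundary p by exact: connected_component_sub.
have Cconn : connected C by exact: component_connected.
have CH : C `&` hull p i = C.
  apply: Cconn; first by exists x.
  - exists (core p i); first exact: open_core.
    apply/seteqP; split=> y [Cy hy]; split=> //; last exact: core_hull.
    by apply: hull_core => //; exact: CB.
  - by exists (hull p i) => //; exact: closed_hull.
exists (`|p i| + `|p (nx i)| + `|p (nx (nx i))| + `|p (nx (nx (nx i)))|).
split; first exact: num_real.
move=> M /ltW leM y; rewrite /= -CH => -[_] hy; apply: le_trans leM; move: hy.
case: s; rewrite /corner !ordS4 => s0 s2 [T|T].
  apply: le_trans (triangle_norm_le s0 T) _.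
  by have := normr_ge0 (p (nx (nx (nx i)))); lra.
apply: le_trans (triangle_norm_le s2 T) _.
by have := normr_ge0 (p (nx i)); lra.
Qed.

(** From a point outside the hull one escapes to infinity along the ray that
    points away from the midpoint of the diagonal: as the hull is star-shaped,
    this ray avoids the hull, hence the curve. *)
Lemma region_hull p i : splits p i -> polygon_region p `<=` hull p i.
Proof.
move=> s x [nbx bd]; apply: contrapT => nhx.
pose m := 2^-1 *: (p i + p (nx (nx i))).
pose ray (r : R) := m + r *: (x - m).
have ray1 : ray 1 = x by rewrite /ray scale1r addrC subrK.
have xm : x - m != 0.
  apply/eqP => /eqP; rewrite subr_eq0 => /eqP xm; apply: nhx.
  have [a1 _ _] := triangle_vertices s.1.
  have := @hull_star p i (p i) 0 s; rewrite scale0r addr0 subr0 scale1r xm.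
  by apply; [rewrite lexx ler01|left].
have rayconn : connected (ray @` `[1, +oo[).
  apply: connected_continuous_connected.
    by apply/connected_intervalP; exact: interval_is_interval.
  apply: continuous_subspaceT => r.
  rewrite (_ : ray = (fun=> m) + (fun r => r *: (x - m))) //.
  by apply: cvgD; [exact: cvg_cst|apply: cvgZr_tmp; exact: cvg_id].
have rayout : ray @` `[1, +oo[ `<=` ~` polygon_boundary p.
  move=> _ [r + <-] /(boundary_hull s) hr; rewrite /= in_itv /= andbT => r1.
  have r0 : 0 < r by rewrite (lt_le_trans ltr01).
  apply: nhx; have := @hull_star p i (ray r) r^-1 s.
  rewrite -/m /ray (scalerDr r^-1 m) (scalerA r^-1 r) mulVf ?gt_eqF // scale1r addrA -scalerDl.
  rewrite subrK scale1r addrC subrK; apply => //.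
  by rewrite invr_ge0 ltW //= invf_le1.
have raysub : ray @` `[1, +oo[ `<=` connected_component (~` polygon_boundary p) x.
  apply: connected_component_max => //.
  by exists 1 => //; rewrite /= in_itv /= lexx.
have [M [_ /(_ (`|M| + 1)) bdM]] := bd.
have {}bdM y : connected_component (~` polygon_boundary p) x y -> `|y| <= `|M| + 1.
  by apply: bdM; have := ler_norm M; lra.
have n0 : 0 < `|x - m| by rewrite normr_gt0.
pose r := 1 + (`|M| + `|m| + 1) / `|x - m|.
have r1 : 1 <= r by rewrite lerDl divr_ge0 // ?addr_ge0 // ltW.
have : `|ray r| <= `|M| + 1.
  by apply/bdM/raysub; exists r => //; rewrite /= in_itv /= r1.
have : `|r *: (x - m)| <= `|ray r| + `|m|.
  rewrite -[in leLHS](addrK m (r *: _)) (addrC (r *: _)).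
  by apply: le_trans (ler_normB _ _) _.
rewrite normrZ (ger0_norm (le_trans ler01 r1)) /r mulrDl mul1r divfK ?gt_eqF //.
by lra.
Qed.

Lemma closure_region p i : splits p i ->
  closure (polygon_region p) `<=` polygon_region p `|` polygon_boundary p.
Proof.
move=> s x clx.
have hx : hull p i x.
  by apply: (closed_hull (p := p) (i := i)); apply: closure_subset clx; exact: region_hull.
case: (pselect (polygon_boundary p x)) => [|nb]; first by right.
by left; exact: hull_region hx nb.
Qed.

End Region.

(** * Affine dependencies of a convex quadrilateral *)

Section ConvexQuad.
Variable R : realType.
Implicit Types (p q : 'I_4 -> 'rV[R]_2) (i j l : 'I_4) (a b c d x y : 'rV[R]_2).

Lemma open_triangle_region p i x : splits p i ->
  0 < orient (p i) (p (nx i)) x -> 0 < orient (p (nx i)) (p (nx (nx i))) x ->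
  0 < orient (p (nx (nx i))) (p i) x -> polygon_region p x.
Proof.
move=> s h0 h1 h2; apply: (hull_region s); first by left; split; apply: ltW.
move=> [l [mu [/andP[mu0 mu1] e]]].
have on_line a b : orient a b ((1 - mu) *: a + mu *: b) = 0.
  by rewrite !orientE !mxE; ring.
have := s.2; rewrite /corner !ordS4 => s2.
move: h0 h1 h2; rewrite e /edge_point; have [] := ord4P i l => ->; rewrite ?ordS4.
- by rewrite on_line ltxx.
- by rewrite on_line ltxx.
- move=> _ _; rewrite orient_comb; apply/negP; rewrite -leNgt.
  rewrite (_ : orient _ _ (p (nx (nx i))) = 0) ?mulr0 ?add0r; last first.
    by rewrite orientE; ring.
  by rewrite mulr_ge0_le0 // orientN orient_rot oppr_le0 -orient_rot -orient_rot ltW.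
- move=> _ _; rewrite orient_comb; apply/negP; rewrite -leNgt.
  rewrite (_ : orient _ _ (p i) = 0) ?mulr0 ?addr0; last first.
    by rewrite orientE; ring.
  rewrite mulr_ge0_le0 ?subr_ge0 // orientN oppr_le0.
  by rewrite -orient_rot -orient_rot ltW // orient_rot orient_rot -orient_rot.
Qed.

(** At a reflex vertex [a] with neighbours [b] and [d] and opposite vertex [c],
    the three directions from [a] positively span the plane. Points near [a]
    in the two triangles, close to the sides [a b] and [a d], can then be
    chosen with their midpoint behind [a], outside the region. *)
Lemma convex_corner_ge0 q i : splits q i -> convex_set (polygon_region q) ->
  0 <= corner q (nx (nx (nx i))).
Proof.
move=> s cvx; rewrite leNgt; apply/negP; rewrite /corner !ordS4 => reflex.
have [C_gt0] := s; rewrite /corner !ordS4 => A_gt0.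
have s' := splits_opposite s.
have rgl x := @open_triangle_region q i x s.
have rgr x := @open_triangle_region q (nx (nx i)) x s'.
have rh := region_hull s.
rewrite !ordS4 /hull /corner in rh rgl rgr C_gt0.
move: C_gt0 A_gt0 reflex rh rgl rgr.
move: (q i) (q (nx i)) (q (nx (nx i))) (q (nx (nx (nx i)))) => a b c d.
set C := orient a b c; set A := orient c d a; set B := orient d a b.
move=> C_gt0 A_gt0 B_lt0 rh rgl rgr.
(* As [A *: (b - a) + C *: (d - a) = B *: (c - a)], the midpoint of the points
   [x] and [y] below is [a + (k * B / 4) *: (c - a)], where [B] is negative. The
   factor [k] keeps [x] and [y] inside the triangles. *)
pose k := (A + C - B)^-1.
have k_gt0 : 0 < k by rewrite invr_gt0; lra.
have kE : k * A + k * C - k * B = 1 by rewrite -mulrDr -mulrBr mulVf // lt0r_neq0 //; lra.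
have kA : 0 < k * A by rewrite mulr_gt0.
have kC : 0 < k * C by rewrite mulr_gt0.
have kB : k * B < 0 by rewrite pmulr_rlt0.
have kBA : k * B * A < 0 by rewrite pmulr_llt0.
have kBC : k * B * C < 0 by rewrite pmulr_llt0.
pose x := a + (k * A) *: (b - a) - (k * B / 4) *: (c - a).
pose y := a + (k * C) *: (d - a) - (k * B / 4) *: (c - a).
have xa : orient a b x = - (k * B / 4) * C by rewrite !orientE /x !mxE /C !orientE; ring.
have xb : orient b c x = (1 - k * A + k * B / 4) * C by rewrite !orientE /x !mxE /C !orientE; ring.
have xc : orient c a x = (k * A) * C by rewrite !orientE /x !mxE /C !orientE; ring.
have xd : orient d a x = (k * A) * B - (k * B / 4) * A.
  by rewrite !orientE /x !mxE /A /B !orientE; ring.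
have yc : orient c d y = (1 - k * C + k * B / 4) * A by rewrite !orientE /y !mxE /A !orientE; ring.
have yd : orient d a y = - (k * B / 4) * A by rewrite !orientE /y !mxE /A !orientE; ring.
have ya : orient a c y = (k * C) * A by rewrite !orientE /y !mxE /A !orientE; ring.
have yb : orient a b y = (k * C) * B - (k * B / 4) * C.
  by rewrite !orientE /y !mxE /B /C !orientE; ring.
have rx : polygon_region q x.
  by apply: rgl; rewrite ?xa ?xb ?xc mulr_gt0 //; lra.
have ry : polygon_region q y.
  by apply: rgr; rewrite ?yc ?yd ?ya mulr_gt0 //; lra.
have half0 : 0 <= (2^-1 : R) by lra.
have half1 : (2^-1 : R) <= 1 by lra.
have := cvx x y (Itv01 half0 half1) (mem_set rx) (mem_set ry).
rewrite inE => /rh; rewrite /conv /= /unstable.onem.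
set z := _ + _.
have zE a' b' : orient a' b' z = 2^-1 * (orient a' b' x + orient a' b' y).
  by rewrite /z addrC orient_comb; lra.
by case=> [[+ _ _]|[_ + _]]; rewrite zE ?xa ?xd ?ya ?yd ?yb; lra.
Qed.

Lemma convex_corners q : simple_closed q -> anticlockwise q ->
  convex_set (polygon_region q) -> forall i, 0 <= corner q i.
Proof.
move=> sq aq cvx; have [i s] := exists_splits sq aq; have [s0 s2] := s.
apply: (forall4 (i := i)); [exact: ltW| |exact: ltW|exact: convex_corner_ge0].
by rewrite -(ordS4 (nx i)); exact: convex_corner_ge0 (splits_opposite s) cvx.
Qed.

(** The affine dependencies between the vertices of [q] form a line, spanned by
    the areas of the corners with alternating signs. *)
Lemma dependency_signs q (dl : 'I_4 -> R) :
  (forall i, 0 <= corner q i) -> anticlockwise q ->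
  \sum_i dl i = 0 -> \sum_i dl i *: q i = 0 ->
  (forall i, 0 <= (-1 : R) ^+ odd i * dl i) \/
  (forall i, 0 <= (-1 : R) ^+ (~~ odd i) * dl i).
Proof.
rewrite /anticlockwise => cq aq d0 dq.
have ratio i : dl i * signed_area2 q = corner q (nx i) * (dl i + dl (nx (nx i))).
  rewrite (corner_sum q (nx i)).
  move: d0 dq; rewrite !(sum4 _ i) => d0 dq.
  have := congr1 (fun y : 'rV[R]_2 => y 0 0) dq.
  have := congr1 (fun y : 'rV[R]_2 => y 0 1) dq.
  rewrite /= !mxE /corner !ordS4 !orientE => e1 e0.
  have e2 : dl (nx i) = - dl i - dl (nx (nx i)) - dl (nx (nx (nx i))) by lra.
  rewrite e2 in e1 e0.
  (* The cross product with the direction of the line through the two other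
     vertices eliminates these from the dependency. *)
  have := congr1 ( *%R (q (nx (nx (nx i))) 0 1 - q (nx i) 0 1)) e0.
  have := congr1 ( *%R (q (nx (nx (nx i))) 0 0 - q (nx i) 0 0)) e1.
  by rewrite !mulr0 => f1 f0; lra.
have pos i : 0 <= dl i + dl (nx (nx i)) -> 0 <= dl i.
  by move=> h; rewrite -(pmulr_lge0 _ aq) ratio mulr_ge0.
have neg i : dl i + dl (nx (nx i)) <= 0 -> dl i <= 0.
  by move=> h; rewrite -(pmulr_lle0 _ aq) ratio mulr_ge0_le0.
have := pos 0; have := neg 0; have := pos (nx 0); have := neg (nx 0).
have := pos (nx (nx 0)); have := neg (nx (nx 0)).
have := pos (nx (nx (nx 0))); have := neg (nx (nx (nx 0))).
move: d0; rewrite !(sum4 _ 0) !ordS4 => d0.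
case: (leP 0 (dl 0 + dl (nx (nx 0)))) => h n3 p3 n2 p2 n1 p1 n0 p0; [left|right];
  apply: (forall4 (i := 0)); rewrite ?odd_ordS4 /= ?expr0 ?expr1.
all: rewrite ?mul1r ?mulN1r ?oppr_ge0; first
 [apply: p0|apply: p1|apply: p2|apply: p3|apply: n0|apply: n1|apply: n2|apply: n3]; lra.
Qed.

End ConvexQuad.

(** * Mean value coordinates inside a quadrilateral *)

Section HalfAngles.
Variable R : realType.
Implicit Types (e f g : 'rV[R]_2) (X Y s t : R).

(** [X + iY] is a square root of the rotation that takes [e] to [f], up to a
    positive factor. *)
Definition spin X Y e f : Prop :=
  (X ^+ 2 + Y ^+ 2) * f 0 0 =
    (X ^+ 2 - Y ^+ 2) * e 0 0 - 2 * X * Y * e 0 1 /\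
  (X ^+ 2 + Y ^+ 2) * f 0 1 =
    (X ^+ 2 - Y ^+ 2) * e 0 1 + 2 * X * Y * e 0 0.

Lemma spin_comp X Y X' Y' e f g : spin X Y e f -> spin X' Y' f g ->
  spin (X * X' - Y * Y') (X * Y' + Y * X') e g.
Proof.
move=> [f0 f1] [g0 g1].
have N : (X * X' - Y * Y') ^+ 2 + (X * Y' + Y * X') ^+ 2 =
    (X ^+ 2 + Y ^+ 2) * (X' ^+ 2 + Y' ^+ 2) by ring.
split; rewrite N -mulrA ?g0 ?g1 ?mulrBr ?mulrDr !(mulrCA (X ^+ 2 + Y ^+ 2)).
  by rewrite f0 f1; ring.
by rewrite f0 f1; ring.
Qed.

Lemma spin_cross X Y e f : dot e e = 1 -> spin X Y e f ->
  (X ^+ 2 + Y ^+ 2) * cross e f = 2 * X * Y.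
Proof.
rewrite /dot /cross => e1 [f0 f1].
rewrite mulrBr !(mulrCA (X ^+ 2 + Y ^+ 2)) f0 f1 -[RHS]mulr1 -e1; ring.
Qed.

(** A rotation that fixes a nonzero vector is the identity, so that its square
    roots are real. *)
Lemma spin_closed X Y e : dot e e = 1 -> spin X Y e e -> Y = 0.
Proof.
rewrite /dot => e1 [e0x e0y].
have : Y ^+ 2 * (e 0 0 * e 0 0 + e 0 1 * e 0 1) = 0.
  have := congr1 ( *%R (e 0 0)) e0x; have := congr1 ( *%R (e 0 1)) e0y; lra.
by rewrite e1 mulr1 => /eqP; rewrite sqrf_eq0 => /eqP.
Qed.

(** For unit vectors the chord [f - e] is orthogonal to [e + f], and [t], the
    tangent of the half-angle, is the ratio of half the chord to the distance
    of its midpoint from the origin. *)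
Lemma spin_tan_sum t e f : spin 1 t e f ->
  t * (e 0 0 + f 0 0) = f 0 1 - e 0 1 /\
  t * (e 0 1 + f 0 1) = e 0 0 - f 0 0.
Proof.
move=> [f0 f1]; have N : 1 ^+ 2 + t ^+ 2 != 0 :> R.
  by rewrite lt0r_neq0 // expr1n ltr_pwDl // sqr_ge0.
split; apply: (mulfI N).
  rewrite mulrBr f1 mulrCA mulrDr f0; ring.
rewrite mulrBr f0 mulrCA mulrDr f1; ring.
Qed.

Lemma angle_exists (u v : R) : u ^+ 2 + v ^+ 2 = 1 -> u != -1 ->
  exists a : R, - pi < a < pi /\ cos a = u /\ sin a = v.
Proof.
move=> uv uN1.
have u2 : u ^+ 2 <= 1 by have := sqr_ge0 v; lra.
have uge : -1 < u by rewrite lt_neqAle eq_sym uN1 /=; nra.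
have ule : u <= 1 by nra.
have uin : -1 <= u <= 1 by rewrite ule ltW.
have cu : cos (acos u) = u by apply: acosK; rewrite in_itv.
have su : sin (acos u) = `|v|.
  by rewrite sin_acos // -sqrtr_sqr; congr Num.sqrt; lra.
have a0 := acos_ge0 uin.
have api : acos u < pi by apply: acos_ltpi; rewrite ule uge.
have pi0 := pi_gt0 R.
case: (leP 0 v) => v0.
  by exists (acos u); rewrite cu su ger0_norm //; split=> //; lra.
exists (- acos u); rewrite cosN sinN cu su ltr0_norm // opprK; split=> //; lra.
Qed.

Lemma tan_half_spin (a : R) e f : dot e e = 1 -> - pi < a < pi ->
  cos a = dot e f -> sin a = cross e f -> spin 1 (tan (a / 2)) e f.
Proof.
move=> e1 api ca sa.
have c0 : cos (a / 2) != 0.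
  by rewrite lt0r_neq0 // cos_gt0_pihalf //; lra.
have a2 : a = (a / 2) *+ 2 by rewrite mulr2n; lra.
rewrite a2 cos_mulr2n in ca; rewrite a2 sin_mulr2n in sa.
have cs := cos2Dsin2 (a / 2).
move: ca sa c0 cs; rewrite /tan.
move: (cos _) (sin _) => c s ca sa c0 cs.
have f0 : f 0 0 = dot e f * e 0 0 - cross e f * e 0 1.
  by rewrite -[LHS]mul1r -e1 /dot /cross; ring.
have f1 : f 0 1 = dot e f * e 0 1 + cross e f * e 0 0.
  by rewrite -[LHS]mul1r -e1 /dot /cross; ring.
have N : 1 ^+ 2 + (s / c) ^+ 2 = c ^- 2.
  by transitivity (c ^- 2 * (c ^+ 2 + s ^+ 2)); [field|rewrite cs mulr1].
have D : 1 ^+ 2 - (s / c) ^+ 2 = c ^- 2 * (c ^+ 2 *+ 2 - 1).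
  transitivity (c ^- 2 * (c ^+ 2 - s ^+ 2)); first by field.
  by congr (_ * _); lra.
have S : 2 * 1 * (s / c) = c ^- 2 * (c * s *+ 2).
  by field.
by rewrite /spin N D S f0 f1 -ca -sa; split; ring.
Qed.

End HalfAngles.

Section TangentSums.
Variable R : realDomainType.

(** The relation is the vanishing of the tangent of the sum of four half-angles.
    Grouped in pairs, it says that the tangents of two complementary half-sums
    are opposite. *)
Lemma tangent_sum_pos1 (t0 t1 t2 t3 : R) :
  0 < t0 -> 0 < t1 -> 1 < t0 * t1 -> 0 < t3 ->
  t0 + t1 + t2 + t3 =
    t1 * t2 * t3 + t0 * t2 * t3 + t0 * t1 * t3 + t0 * t1 * t2 ->
  0 < t1 + t2 /\ 0 < t2 + t3.
Proof.
move=> h0 h1 h01 h3 e.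
case: (ltP 0 t2) => h2; first by split; apply: addr_gt0.
have e23 : (t0 + t1) * (1 - t2 * t3) = (t2 + t3) * (t0 * t1 - 1).
  by rewrite -[LHS]subr0 -(subrr (t0 + t1 + t2 + t3)) {2}e; ring.
have e12 : (t1 + t2) * (t0 * t3 - 1) = (t0 + t3) * (1 - t1 * t2).
  by rewrite -[LHS]subr0 -(subrr (t0 + t1 + t2 + t3)) {1}e; ring.
have p23 : 0 < t2 + t3.
  rewrite -(pmulr_lgt0 _ (_ : 0 < t0 * t1 - 1)) ?subr_gt0 // -e23.
  by apply: mulr_gt0; nra.
split=> //; rewrite ltNge; apply/negP => h12.
(* Now [t3] exceeds [t1]: the angles of [t0] and [t3] make more than a half-turn
   together, which leaves a positive sum for the two others. *)
have h03 : 1 < t0 * t3 by apply: lt_trans h01 _; rewrite ltr_pM2l //; lra.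
have : 0 < (t0 + t3) * (1 - t1 * t2) by apply: mulr_gt0; nra.
by rewrite -e12; apply/negP; rewrite -leNgt mulr_le0_ge0 // subr_ge0 ltW.
Qed.

Lemma tangent_sum_pos (t0 t1 t2 t3 : R) :
  0 < t0 -> 0 < t1 -> 1 < t0 * t1 -> 0 < t2 \/ 0 < t3 ->
  t0 + t1 + t2 + t3 =
    t1 * t2 * t3 + t0 * t2 * t3 + t0 * t1 * t3 + t0 * t1 * t2 ->
  [/\ 0 < t0 + t1, 0 < t1 + t2, 0 < t2 + t3 & 0 < t3 + t0].
Proof.
move=> h0 h1 h01 [h2|h3] e.
  have [||h30 h32] := @tangent_sum_pos1 t1 t0 t3 t2 h1 h0 _ h2.
  - by rewrite mulrC.
  - lra.
  by split; try exact: addr_gt0; rewrite addrC.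
have [h12 h23] := tangent_sum_pos1 h0 h1 h01 h3 e.
by split=> //; apply: addr_gt0.
Qed.

End TangentSums.

Section MeanValue.
Variable R : realType.
Implicit Types (p q : 'I_4 -> 'rV[R]_2) (i j l : 'I_4) (x y : 'rV[R]_2).

Lemma mv_dist_gt0 p x j : ~ polygon_boundary p x -> 0 < mv_dist p x j.
Proof.
move=> nb; rewrite lt_neqAle enorm_ge0 andbT eq_sym enorm_eq0 subr_eq0.
apply/eqP => e; apply: nb; exists j, 0; rewrite lexx ler01; split=> //.
by rewrite /edge_point subr0 scale1r scale0r addr0.
Qed.

Lemma mv_dir_unit p x j : ~ polygon_boundary p x ->
  dot (mv_dir p x j) (mv_dir p x j) = 1.
Proof.
move=> nb; have r0 := mv_dist_gt0 j nb.
by rewrite -sqr_enorm enormZ gtr0_norm ?invr_gt0 // mulVf ?expr1n // gt_eqF.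
Qed.

Lemma mv_dirE p x j : ~ polygon_boundary p x ->
  mv_dist p x j *: mv_dir p x j = p j - x.
Proof.
by move=> nb; rewrite scalerA divff ?scale1r // gt_eqF // mv_dist_gt0.
Qed.

(** Opposite directions to the ends of an edge would put [x] on that edge. *)
Lemma mv_dir_not_opposite p x j : ~ polygon_boundary p x ->
  dot (mv_dir p x j) (mv_dir p x (nx j)) != -1.
Proof.
move=> nb; apply/eqP => opp.
have r0 := mv_dist_gt0 j nb; have r1 := mv_dist_gt0 (nx j) nb.
have s0 : enorm (mv_dir p x j + mv_dir p x (nx j)) = 0.
  apply/eqP; rewrite -sqrf_eq0 sqr_enormD !sqr_enorm !mv_dir_unit // opp.
  by apply/eqP; ring.
move/eqP: s0; rewrite enorm_eq0 addr_eq0 => /eqP de.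
have e0 := mv_dirE j nb; have e1 := mv_dirE (nx j) nb.
move: r0 r1 e0 e1; rewrite de; move: (mv_dist p x j) (mv_dist p x (nx j)) => r r'.
move: (mv_dir p x (nx j)) => v r0 r1 e0 e1; apply: nb.
exists j, (r / (r + r')); split; first by apply: ratio_itv01; lra.
have s0 : r + r' != 0 by rewrite lt0r_neq0 // addr_gt0.
apply: (scalerI s0); rewrite /edge_point scalerDr !scalerA mulrBr mulr1.
rewrite mulrCA divff // mulr1 (addrC r) addrK.
have -> : p j = x - r *: v by rewrite -[r *: v]opprK -scalerN e0 opprK addrC subrK.
have -> : p (nx j) = x + r' *: v by rewrite e1 addrC subrK.
by apply: row2P; rewrite !mxE; ring.
Qed.

Lemma mv_tan_spin p x j : ~ polygon_boundary p x ->
  spin 1 (mv_tan p x j) (mv_dir p x j) (mv_dir p x (nx j)).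
Proof.
move=> nb; have u := mv_dir_unit j nb; have u' := mv_dir_unit (nx j) nb.
set A := [set a : R | - pi < a < pi /\
    cos a = dot (mv_dir p x j) (mv_dir p x (ordS j)) /\
    sin a = cross (mv_dir p x j) (mv_dir p x (ordS j))].
have [a Aa] : exists a, A a.
  apply: angle_exists; last exact: mv_dir_not_opposite.
  by rewrite -lagrange_identity exprMn !sqr_enorm u u' mulr1.
have [h [c s]] : A (mv_angle p x j) by apply: xgetPex; exists a.
exact: tan_half_spin.
Qed.

Lemma orient_dir p x j l : ~ polygon_boundary p x ->
  orient (p j) (p l) x =
    mv_dist p x j * mv_dist p x l * cross (mv_dir p x j) (mv_dir p x l).
Proof.
move=> nb; have := mv_dirE j nb; have := mv_dirE l nb.
move: (mv_dist p x j) (mv_dir p x j) (mv_dist p x l) (mv_dir p x l) => s f r e.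
move=> el ej.
have -> : p j = x + s *: f by rewrite ej addrC subrK.
have -> : p l = x + r *: e by rewrite el addrC subrK.
by rewrite orientE /cross !mxE; ring.
Qed.

Lemma mv_tan_gt0 p x j : ~ polygon_boundary p x ->
  (0 < mv_tan p x j) = (0 < orient (p j) (p (nx j)) x).
Proof.
move=> nb; have u := mv_dir_unit j nb.
have rr : 0 < mv_dist p x j * mv_dist p x (nx j) by rewrite mulr_gt0 // mv_dist_gt0.
rewrite orient_dir // (pmulr_rgt0 _ rr).
have N : 0 < 1 ^+ 2 + mv_tan p x j ^+ 2 by rewrite expr1n ltr_pwDl // sqr_ge0.
rewrite -[RHS](pmulr_rgt0 _ N) (spin_cross u (mv_tan_spin j nb)) mulr1.
by rewrite [RHS]pmulr_rgt0 ?ltr0n.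
Qed.

(** Going once around the four directions leads back to the first one: the
    imaginary part of the product of the [1 + i t_j] vanishes. *)
Lemma mv_tan_closed p x i (t := mv_tan p x) : ~ polygon_boundary p x ->
  t i + t (nx i) + t (nx (nx i)) + t (nx (nx (nx i))) =
    t (nx i) * t (nx (nx i)) * t (nx (nx (nx i))) +
    t i * t (nx (nx i)) * t (nx (nx (nx i))) +
    t i * t (nx i) * t (nx (nx (nx i))) +
    t i * t (nx i) * t (nx (nx i)).
Proof.
move=> nb.
have := spin_comp (mv_tan_spin i nb) (mv_tan_spin (nx i) nb).
move=> /spin_comp/(_ (mv_tan_spin (nx (nx i)) nb)).
move=> /spin_comp/(_ (mv_tan_spin (nx (nx (nx i))) nb)); rewrite ordS4.
move=> /(spin_closed (mv_dir_unit i nb)); rewrite -/t => Y0.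
by apply/eqP; rewrite -subr_eq0 -{}Y0; apply/eqP; ring.
Qed.

(** Inside the triangle of the first three vertices, the first two angles are
    positive and exceed a half-turn together. The other two are not both
    nonpositive, for the other triangle would then be clockwise. *)
Lemma mv_tan_sum_triangle p x i (t := mv_tan p x) :
  splits p i -> ~ polygon_boundary p x ->
  0 < orient (p i) (p (nx i)) x -> 0 < orient (p (nx i)) (p (nx (nx i))) x ->
  0 < orient (p (nx (nx i))) (p i) x -> forall j, 0 < t j + t (nx j).
Proof.
move=> [_ s2] nb h0 h1 d.
have t0 : 0 < t i by rewrite mv_tan_gt0.
have t1 : 0 < t (nx i) by rewrite mv_tan_gt0.
(* The sine of the sum of the first two angles is negative. *)
have t01 : 1 < t i * t (nx i).
  have sp := spin_comp (mv_tan_spin i nb) (mv_tan_spin (nx i) nb).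
  have := spin_cross (mv_dir_unit i nb) sp; rewrite -/t !mul1r mulr1 => cr.
  have cr_lt0 : cross (mv_dir p x i) (mv_dir p x (nx (nx i))) < 0.
    move: d; rewrite orientN orient_dir // oppr_gt0 pmulr_rlt0 //.
    by rewrite mulr_gt0 // mv_dist_gt0.
  have N : 0 < (1 - t i * t (nx i)) ^+ 2 + (t (nx i) + t i) ^+ 2.
    by rewrite ltr_wpDl ?sqr_ge0 // exprn_gt0 // addr_gt0.
  move: cr_lt0; rewrite -(pmulr_rlt0 _ N) cr pmulr_llt0 ?addr_gt0 //.
  by rewrite pmulr_rlt0 // subr_lt0.
have t23 : 0 < t (nx (nx i)) \/ 0 < t (nx (nx (nx i))).
  rewrite !mv_tan_gt0 // ordS4.
  case: (ltP 0 (orient (p (nx (nx i))) (p (nx (nx (nx i)))) x)) => h2; first by left.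
  case: (ltP 0 (orient (p (nx (nx (nx i)))) (p i) x)) => h3; first by right.
  move: s2; rewrite /corner !ordS4 (orient_barycentric_sum _ _ _ x).
  by rewrite (orientN (p i)); lra.
have [? ? ? ?] := tangent_sum_pos t0 t1 t01 t23 (mv_tan_closed i nb).
by apply: (forall4 (i := i)); rewrite ?ordS4.
Qed.

Lemma mv_tan_sum_gt0 p x i : splits p i -> polygon_region p x ->
  forall j, 0 < mv_tan p x j + mv_tan p x (nx j).
Proof.
move=> s rx; have [nb _] := rx.
have [[h0 h1 d]|[h2 h3 d]|h] := hull_core s (region_hull s rx) nb.
- exact: mv_tan_sum_triangle s nb h0 h1 d.
- rewrite ordS4 in h3; apply: mv_tan_sum_triangle (splits_opposite s) nb _ _ _ => //.
    by rewrite ordS4.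
  by rewrite ordS4 orientN oppr_gt0.
- by move=> j; rewrite addr_gt0 // mv_tan_gt0.
Qed.

Lemma mv_weight_dist p x j : ~ polygon_boundary p x ->
  mv_weight p x j * mv_dist p x j = mv_tan p x (ord_pred j) + mv_tan p x j.
Proof. by move=> nb; rewrite /mv_weight divfK // gt_eqF // mv_dist_gt0. Qed.

(** By [spin_tan_sum] the sum is that of the differences of consecutive
    directions, turned by a quarter, and it telescopes. *)
Lemma mv_weight_balanced p x : ~ polygon_boundary p x ->
  \sum_j mv_weight p x j *: (p j - x) = 0.
Proof.
move=> nb.
under eq_bigr => j _ do rewrite -(mv_dirE j nb) scalerA mv_weight_dist // ord_pred4.
rewrite (sum4 _ 0) !ordS4.
have [a0 b0] := spin_tan_sum (mv_tan_spin 0 nb).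
have [a1 b1] := spin_tan_sum (mv_tan_spin (nx 0) nb).
have [a2 b2] := spin_tan_sum (mv_tan_spin (nx (nx 0)) nb).
have [a3 b3] := spin_tan_sum (mv_tan_spin (nx (nx (nx 0))) nb).
rewrite !ordS4 in a3 b3; move: a0 b0 a1 b1 a2 b2 a3 b3.
move: (mv_dir p x) (mv_tan p x) => e t a0 b0 a1 b1 a2 b2 a3 b3.
by apply: row2P; rewrite !mxE; lra.
Qed.

(** This is the invariant of the map: every tangent [t_j] occurs in the terms of
    the two consecutive indices [j] and [j + 1], with opposite signs. *)
Lemma mv_weight_moment p x : ~ polygon_boundary p x ->
  \sum_(j < 4) (-1 : R) ^+ odd j * (mv_weight p x j * mv_dist p x j) = 0.
Proof.
move=> nb; under eq_bigr => j _ do rewrite mv_weight_dist // ord_pred4.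
by rewrite (sum4 _ 0) !ordS4 !odd_ordS4 /= expr1 expr0; ring.
Qed.

Lemma mv_coord_region p x : simple_closed p -> anticlockwise p ->
  polygon_region p x ->
  [/\ forall i, 0 < mv_coord p i x, barycentric p (mv_coord p ^~ x) x &
      alternating_moment p (fun i => odd i) (mv_coord p ^~ x) x = 0].
Proof.
move=> sp ap rx; have [nb _] := rx; have [i s] := exists_splits sp ap.
have w_gt0 j : 0 < mv_weight p x j.
  rewrite divr_gt0 ?mv_dist_gt0 //.
  by have := mv_tan_sum_gt0 s rx (ord_pred j); rewrite ord_predK.
set W := \sum_j mv_weight p x j.
have W_gt0 : 0 < W by rewrite /W (sum4 _ i) !addr_gt0.
have W_neq0 := lt0r_neq0 W_gt0.
have cE j : mv_coord p j x = W^-1 * mv_weight p x j.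
  by rewrite /mv_coord mem_set // mulrC.
have c_gt0 j : 0 < mv_coord p j x by rewrite cE mulr_gt0 // invr_gt0.
have sum1 : \sum_j mv_coord p j x = 1.
  by under eq_bigr do rewrite cE; rewrite -mulr_sumr mulVf.
split=> //.
  split=> // [j|]; first exact: ltW.
  apply/eqP; rewrite -subr_eq0 -[X in _ - X]scale1r -sum1 scaler_suml -sumrB.
  under eq_bigr do rewrite -scalerBr cE -scalerA.
  by rewrite -scaler_sumr mv_weight_balanced // scaler0.
rewrite /alternating_moment.
under eq_bigr do rewrite cE -mulrA mulrCA.
by rewrite -mulr_sumr mv_weight_moment // mulr0.
Qed.

Lemma edge_values l (mu : R) :
  [/\ edge_value l l mu = 1 - mu, edge_value (nx l) l mu = mu,
      edge_value (nx (nx l)) l mu = 0 & edge_value (nx (nx (nx l))) l mu = 0].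
Proof.
rewrite /edge_value !eqxx.
by case: l => [[|[|[|[|]]]]].
Qed.

Lemma mv_coord_boundary_facts p x : simple_closed p -> polygon_boundary p x ->
  barycentric p (mv_coord p ^~ x) x /\
  alternating_moment p (fun i => odd i) (mv_coord p ^~ x) x = 0.
Proof.
move=> sp [l [mu [mu01 xE]]].
have cE j : mv_coord p j x = edge_value j l mu by rewrite xE mv_coord_boundary.
have [v0 v1 v2 v3] := edge_values l mu; have /andP[mu0 mu1] := mu01.
split; first split.
- by apply: (forall4 (i := l)); rewrite cE ?v0 ?v1 ?v2 ?v3 //; lra.
- by rewrite (sum4 _ l) !cE v0 v1 v2 v3; ring.
- by rewrite (sum4 _ l) !cE v0 v1 v2 v3 !scale0r !addr0 xE.
rewrite /alternating_moment (sum4 _ l) !cE v0 v1 v2 v3 !mul0r !mulr0 !addr0.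
have -> : p l - x = mu *: (p l - p (nx l)).
  by rewrite xE /edge_point; apply: row2P; rewrite !mxE; ring.
have -> : p (nx l) - x = (1 - mu) *: - (p l - p (nx l)).
  by rewrite xE /edge_point; apply: row2P; rewrite !mxE; ring.
rewrite !enormZ enormN !ger0_norm ?subr_ge0 // odd_ordS4.
by case: (odd l); rewrite /= ?expr0 ?expr1; ring.
Qed.

(** * Injectivity *)

Lemma mv_map_boundary p q l (mu : R) : simple_closed p -> 0 <= mu <= 1 ->
  mv_map p q (edge_point p l mu) = edge_point q l mu.
Proof.
move=> sp mu01; rewrite /mv_map.
under eq_bigr do rewrite mv_coord_boundary //.
have [v0 v1 v2 v3] := edge_values l mu.
by rewrite (sum4 _ l) v0 v1 v2 v3 !scale0r !addr0.
Qed.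

Lemma mv_map_boundary_inj p q x y : simple_closed p -> simple_closed q ->
  polygon_boundary p x -> polygon_boundary p y ->
  mv_map p q x = mv_map p q y -> x = y.
Proof.
move=> sp sq [l [mu [mu01 ->]]] [l' [mu' [mu01' ->]]].
have [l1 [m1 [_ h1 e1]]] := edge_point_half_open l mu01.
have [l2 [m2 [_ h2 e2]]] := edge_point_half_open l' mu01'.
have w1 : 0 <= m1 <= 1 by case/andP: h1 => -> /ltW.
have w2 : 0 <= m2 <= 1 by case/andP: h2 => -> /ltW.
by rewrite e1 e2 !mv_map_boundary // => /(sq _ _ _ _ h1 h2)[-> ->].
Qed.

Lemma alternating_momentN p (eps : 'I_4 -> bool) b x :
  alternating_moment p (fun i => ~~ eps i) b x = - alternating_moment p eps b x.
Proof.
rewrite /alternating_moment -sumrN; apply: eq_bigr => i _.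
by case: (eps i); rewrite /= ?expr0 ?expr1 ?mul1r ?mulN1r ?opprK.
Qed.

Lemma cross_parallel (d u v : 'rV[R]_2) : d != 0 ->
  cross u d = 0 -> cross v d = 0 -> cross u v = 0.
Proof.
move=> d0 ud vd; apply/eqP; apply: contraT => uv; case/eqP: d0.
have e k : cross u v * d 0 k = cross u d * v 0 k - cross v d * u 0 k.
  have /orP[/eqP->|/eqP->] : (k == 0) || (k == 1) by case: k => [[|[|]]].
  - by rewrite /cross; ring.
  - by rewrite /cross; ring.
by apply: row2P; apply: (mulfI uv); rewrite e ud vd !mul0r subrr mxE mulr0.
Qed.

(** One interior point suffices for rigidity, as its coordinates are all
    positive; the other point may be on the boundary. *)
Lemma mv_map_region_inj p q x y : simple_closed p -> anticlockwise p ->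
  (forall i, 0 <= corner q i) -> anticlockwise q ->
  polygon_boundary p x \/ polygon_region p x -> polygon_region p y ->
  mv_map p q x = mv_map p q y -> x = y.
Proof.
move=> sp ap cq aq hx ry fxy.
have [c_gt0 by_ my] := mv_coord_region sp ap ry.
have [bx mx] : barycentric p (mv_coord p ^~ x) x /\
    alternating_moment p (fun i => odd i) (mv_coord p ^~ x) x = 0.
  by case: hx => [/(mv_coord_boundary_facts sp)//|/(mv_coord_region sp ap)[]].
apply/eqP; rewrite -subr_eq0; apply: contraT => xy.
have [_ sx _] := bx; have [_ sy _] := by_.
have al : forall i, cross (p i - x) (x - y) = 0.
  have [||sg|sg] := @dependency_signs _ q
    (fun i => mv_coord p i x - mv_coord p i y) cq aq.
  - by rewrite sumrB sx sy subrr.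
  - under eq_bigr do rewrite scalerBl.
    by apply/eqP; rewrite sumrB subr_eq0; apply/eqP.
  - by apply: alternating_moment_aligned bx by_ sg _ c_gt0; rewrite mx my.
  - apply: alternating_moment_aligned bx by_ sg _ c_gt0.
    by rewrite !alternating_momentN mx my.
have c0 i : corner p i = 0.
  apply: (cross_parallel xy).
    by move: (al i) (al (nx i)); rewrite /cross !mxE; lra.
  by move: (al i) (al (nx (nx i))); rewrite /cross !mxE; lra.
by move: ap; rewrite /anticlockwise (corner_sum p 0) !c0 addr0 ltxx.
Qed.

End MeanValue.

Theorem theorem1 (R : realType) (p q : 'I_4 -> 'rV[R]_2)
    (p_simple : simple_closed p) (p_ccw : anticlockwise p)
    (q_simple : simple_closed q) (q_ccw : anticlockwise q)
    (q_convex : convex_set (polygon_region q)) :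
  set_inj (closure (polygon_region p)) (mv_map p q).
Proof.
have cq := convex_corners q_simple q_ccw q_convex.
have [i s] := exists_splits p_simple p_ccw.
move=> x y; rewrite !inE => /(closure_region s) hx /(closure_region s) hy fxy.
case: hx hy => [rx|bx] [ry|by_].
- by apply: (mv_map_region_inj p_simple p_ccw cq) fxy => //; right.
- by apply/esym; apply: (mv_map_region_inj p_simple p_ccw cq) (esym fxy) => //; left.
- by apply: (mv_map_region_inj p_simple p_ccw cq) fxy => //; left.
- exact: (mv_map_boundary_inj p_simple q_simple) fxy.
Qed.
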